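(* Let $E\subseteq\mathbb{R}^n$ be a set with positive reach and let $x_0\in\partial E$. For $\rho>0$ set $E_{x_0,\rho}=\frac{E-x_0}{\rho}$. Then for all $r>0$ the sets $E_{x_0,\rho}\cap\overline{B_r(0)}$ converge with respect to the Hausdorff distance, as $\rho\to0^+$, to $\mathrm{Tan}(E,x_0)\cap\overline{B_r(0)}$.
   Context: $n\ge2$; $B_r(0)$ is the open ball of center $0$ and radius $r$. $\delta_E(x)=\inf_{y\in E}\|x-y\|$. $\mathrm{Unp}(E)$ is the set of $y\in\mathbb{R}^n$ for which there is a unique $x\in E$ with $\delta_E(y)=\|x-y\|$. For $x\in E$, $\mathrm{reach}(E,x)=\sup\{r>0: B_r(x)\subseteq\mathrm{Unp}(E)\}$ and $\mathrm{reach}(E)=\inf_{x\in E}\mathrm{reach}(E,x)$. $E$ has positive reach if $\mathrm{reach}(E)>0$ (such a set is closed). For an accumulation point $x\in E$ of $E$, the tangent cone $\mathrm{Tan}(E,x)$ is the set of $\lambda v$ with $\lambda\ge0$ and $v=\lim_h\frac{x_h-x}{\|x_h-x\|}$ for some sequence $x_h\in E$, $x_h\ne x$, $x_h\to x$; if $x$ is isolated in $E$, $\mathrm{Tan}(E,x)=\{0\}$. The Hausdorff distance between nonempty closed sets $A,B$ is $\inf\{t>0: B\subseteq[A]_t,\ A\subseteq[B]_t\}$, where $[A]_t=\{x:\delta_A(x)\le t\}$. *)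

(* Defs.v *)
From mathcomp Require Import all_boot all_order all_algebra.
From mathcomp Require Import all_classical all_reals all_analysis.

Set Implicit Arguments.
Unset Strict Implicit.
Unset Printing Implicit Defensive.

Import Order.TTheory GRing.Theory Num.Theory.
Import numFieldNormedType.Exports.

Local Open Scope classical_set_scope.
Local Open Scope ring_scope.

(* The norm `|x| of MathComp-Analysis on row vectors is the sup norm, so every
   metric notion is built on the Euclidean norm below.  The library topology on
   'rV[R]_n is the usual one of R^n; it is used for closures, interiors, limit
   points and limits of sequences. *)
Definition enorm (R : realType) (n : nat) (x : 'rV[R]_n) : R :=
  Num.sqrt (\sum_(i < n) x ord0 i ^+ 2).

Definition eball (R : realType) (n : nat) (x : 'rV[R]_n) (r : R) :
    set 'rV[R]_n :=
  [set y | enorm (y - x) < r].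

Definition boundary (R : realType) (n : nat) (E : set 'rV[R]_n) :
    set 'rV[R]_n :=
  closure E `\` interior E.

(* Infima and suprema are taken in \bar R: the distance to the empty set is
   +oo, and reach may be +oo (e.g. for convex sets). *)
Definition edist_to (R : realType) (n : nat) (E : set 'rV[R]_n)
    (x : 'rV[R]_n) : \bar R :=
  ereal_inf [set (enorm (x - y))%:E | y in E].

Definition Unp (R : realType) (n : nat) (E : set 'rV[R]_n) :
    set 'rV[R]_n :=
  [set y | exists! x : 'rV[R]_n, E x /\ edist_to E y = (enorm (x - y))%:E].

(* If no ball around x lies in Unp E, this is -oo instead of the usual 0; the
   condition [0 < reach E] is insensitive to this convention. *)
Definition reach_at (R : realType) (n : nat) (E : set 'rV[R]_n)
    (x : 'rV[R]_n) : \bar R :=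
  ereal_sup [set r%:E | r in [set r : R | 0 < r /\ eball x r `<=` Unp E]].

Definition reach (R : realType) (n : nat) (E : set 'rV[R]_n) : \bar R :=
  ereal_inf [set reach_at E x | x in E].

Definition positive_reach (R : realType) (n : nat) (E : set 'rV[R]_n) : Prop :=
  (0 < reach E)%E.

Definition Tan (R : realType) (n : nat) (E : set 'rV[R]_n) (x : 'rV[R]_n) :
    set 'rV[R]_n :=
  [set w | (isolated E x /\ w = 0) \/
    (limit_point E x /\
     exists (lam : R) (v : 'rV[R]_n) (u : nat -> 'rV[R]_n),
       [/\ 0 <= lam,
           forall h : nat, E (u h) /\ u h <> x,
           u h @[h --> \oo] --> x,
           (enorm (u h - x))^-1 *: (u h - x) @[h --> \oo] --> v &
           w = lam *: v])].

Definition thickening (R : realType) (n : nat) (A : set 'rV[R]_n) (t : R) :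
    set 'rV[R]_n :=
  [set x | (edist_to A x <= t%:E)%E].

Definition hausdorff_dist (R : realType) (n : nat) (A B : set 'rV[R]_n) :
    \bar R :=
  ereal_inf [set t%:E | t in
    [set t : R | [/\ 0 < t, B `<=` thickening A t & A `<=` thickening B t]]].

Definition blowup (R : realType) (n : nat) (E : set 'rV[R]_n)
    (x0 : 'rV[R]_n) (rho : R) : set 'rV[R]_n :=
  [set rho^-1 *: (x - x0) | x in E].

(* Main.v *)
Require Import Defs.
From mathcomp Require Import all_boot all_order all_algebra.
From mathcomp Require Import all_classical all_reals all_analysis.
From mathcomp Require Import ring lra.
Import Order.TTheory GRing.Theory Num.Theory.
Import numFieldNormedType.Exports.
Local Open Scope classical_set_scope.
Local Open Scope ring_scope.

(* Let every point within distance s of E have a unique nearest point in E, as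
   positive reach provides.  If x is such a point, with nearest point p, then the
   distance to E keeps growing at unit speed along the ray from p through x as
   long as it is less than s: maximizing the distance over a small ball around
   x, the maximum is attained on this ray because the nearest point map is
   continuous.  So E avoids an open ball of radius s / 2 tangent at p, i.e.
   s <b - p, x - p> <= |b - p|^2 |x - p| for all b in E.  Applying this to
   x = x0 + t v, with b = x0 and with one b in E seen from x0 in a direction
   close to v at a small distance r >= 2 t, gives dist (x, E) <= eps t: one point
   of E near the ray forces E to follow the ray at all smaller scales.  Hence
   the tangent directions are approached by the blow-ups at every scale,
   uniformly by compactness of the unit sphere; the converse inclusion is
   compactness alone. *)

(** * Euclidean norm and topology of R^n *)

Section Euclidean.
Context {R : realType} {n : nat}.
Implicit Types (x y z : 'rV[R]_n) (a t : R).

Definition dotv x y : R := \sum_(i < n) x ord0 i * y ord0 i.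

Lemma dotvC x y : dotv x y = dotv y x.
Proof. by apply: eq_bigr => i _; rewrite mulrC. Qed.

Lemma dotvDl x y z : dotv (x + y) z = dotv x z + dotv y z.
Proof. by rewrite -big_split; apply: eq_bigr => i _; rewrite !mxE mulrDl. Qed.

Lemma dotvZl a x y : dotv (a *: x) y = a * dotv x y.
Proof. by rewrite mulr_sumr; apply: eq_bigr => i _; rewrite !mxE mulrA. Qed.

Lemma dotvNl x y : dotv (- x) y = - dotv x y.
Proof. by rewrite -scaleN1r dotvZl mulN1r. Qed.

Lemma dotvBl x y z : dotv (x - y) z = dotv x z - dotv y z.
Proof. by rewrite dotvDl dotvNl. Qed.

Lemma dotvDr x y z : dotv x (y + z) = dotv x y + dotv x z.
Proof. by rewrite !(dotvC x) dotvDl. Qed.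

Lemma dotvZr a x y : dotv x (a *: y) = a * dotv x y.
Proof. by rewrite !(dotvC x) dotvZl. Qed.

Lemma dotvNr x y : dotv x (- y) = - dotv x y.
Proof. by rewrite !(dotvC x) dotvNl. Qed.

Lemma dotvBr x y z : dotv x (y - z) = dotv x y - dotv x z.
Proof. by rewrite dotvDr dotvNr. Qed.

Definition dotvE :=
  (dotvDl, dotvBl, dotvDr, dotvBr, dotvZl, dotvZr, dotvNl, dotvNr).

Lemma enorm_ge0 x : 0 <= enorm x.
Proof. exact: sqrtr_ge0. Qed.

Lemma sqr_enorm x : enorm x ^+ 2 = dotv x x.
Proof.
rewrite sqr_sqrtr; last by apply: sumr_ge0 => i _; exact: sqr_ge0.
by apply: eq_bigr => i _; rewrite expr2.
Qed.

Lemma enorm0 : enorm (0 : 'rV[R]_n) = 0.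
Proof.
rewrite /enorm big1 ?sqrtr0// => i _.
by rewrite mxE expr0n.
Qed.

Lemma enorm_eq0 x : enorm x = 0 -> x = 0.
Proof.
move=> /(congr1 (fun t : R => t ^+ 2)); rewrite sqr_enorm expr0n/= => /eqP.
rewrite psumr_eq0 => [/allP h|i _]; last by rewrite -expr2 sqr_ge0.
apply/rowP => i; rewrite mxE; apply/eqP.
by have := h i (mem_index_enum _); rewrite mulf_eq0 orbb.
Qed.

Lemma enormZ a x : enorm (a *: x) = `|a| * enorm x.
Proof.
rewrite /enorm -sqrtr_sqr -sqrtrM ?sqr_ge0// mulr_sumr.
by congr Num.sqrt; apply: eq_bigr => i _; rewrite mxE exprMn.
Qed.

Lemma enormN x : enorm (- x) = enorm x.
Proof. by rewrite -scaleN1r enormZ normrN1 mul1r. Qed.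

Lemma enorm_distC x y : enorm (x - y) = enorm (y - x).
Proof. by rewrite -opprB enormN. Qed.

Lemma enorm_gt0 x : x != 0 -> 0 < enorm x.
Proof.
move=> x0; rewrite lt_neqAle enorm_ge0 andbT eq_sym.
by apply: contra_neq x0; exact: enorm_eq0.
Qed.

Lemma le_dotv x y : dotv x y <= enorm x * enorm y.
Proof.
have [->|/enorm_gt0 x0] := eqVneq x 0.
  by rewrite enorm0 mul0r -(scale0r (0 : 'rV[R]_n)) dotvZl mul0r.
have [->|/enorm_gt0 y0] := eqVneq y 0.
  by rewrite enorm0 mulr0 -(scale0r (0 : 'rV[R]_n)) dotvZr mul0r.
have := sqr_ge0 (enorm (enorm y *: x - enorm x *: y)).
rewrite sqr_enorm !dotvE (dotvC y x) -!sqr_enorm => h.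
have xy0 : 0 < enorm x * enorm y by exact: mulr_gt0.
rewrite -(ler_pM2l xy0); nra.
Qed.

Lemma sqr_enormD x y :
  enorm (x + y) ^+ 2 = enorm x ^+ 2 + 2 * dotv x y + enorm y ^+ 2.
Proof. rewrite !sqr_enorm !dotvE (dotvC y x); ring. Qed.

Lemma ler_enormD x y : enorm (x + y) <= enorm x + enorm y.
Proof.
rewrite -(@ler_pXn2r _ 2)// ?nnegrE ?addr_ge0 ?enorm_ge0//.
rewrite sqr_enormD; have := le_dotv x y; nra.
Qed.

Lemma ler_enorm_dist z x y : enorm (x - y) <= enorm (x - z) + enorm (z - y).
Proof. by rewrite (le_trans _ (ler_enormD _ _))// addrA subrK. Qed.

Lemma ler_norm_enorm x i : `|x ord0 i| <= enorm x.
Proof.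
rewrite -(@ler_pXn2r _ 2)// ?nnegrE ?enorm_ge0// sqr_enorm real_normK ?num_real//.
rewrite /dotv (bigD1 i)//= -expr2 lerDl.
by apply: sumr_ge0 => j _; rewrite -expr2 sqr_ge0.
Qed.

Lemma eball_nbhs x t : 0 < t -> nbhs x (eball x t).
Proof.
move=> t0; apply/nbhs_ballP.
have n0 : 0 < n.+1%:R :> R by rewrite ltr0n.
(* A sup-norm ball of radius $t/(n+1)$ suffices, since $n\,(t/(n+1))^2<t^2$; the successor also
   covers $n=0$. *)
exists (t / n.+1%:R) => /=; first by rewrite divr_gt0.
move=> y [_ xy]; rewrite /eball/=.
rewrite -(@ltr_pXn2r _ 2)// ?nnegrE ?enorm_ge0 ?(ltW t0)// sqr_enorm.
apply: (@le_lt_trans _ _ (\sum_(i < n) (t / n.+1%:R) ^+ 2)).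
  apply: ler_sum => i _; rewrite -expr2 -real_normK ?num_real//.
  rewrite ler_pXn2r ?nnegrE ?divr_ge0 ?(ltW t0) ?(ltW n0)//.
  by rewrite !mxE distrC; exact: ltW (xy ord0 i).
rewrite sumr_const card_ord exprMn -[ltLHS]mulr_natr -mulrA gtr_pMr ?exprn_gt0//.
rewrite exprVn ltr_pdivrMl ?exprn_gt0// mulr1 -natrX ltr_nat.
by rewrite -mulnn leq_pmulr.
Qed.

Lemma nbhs_eballP x (A : set 'rV[R]_n) :
  nbhs x A <-> exists2 t : R, 0 < t & eball x t `<=` A.
Proof.
split=> [/nbhs_ballP[t t0 tA]|[t t0 /filterS]]; last by apply; exact: eball_nbhs.
exists t => // y xy; apply: tA; split=> // i j.
rewrite (ord1 i) /ball/= distrC.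
apply: le_lt_trans xy; apply: le_trans (ler_norm_enorm _ j).
by rewrite !mxE; exact: lexx.
Qed.

Lemma cvg_enormP (u : nat -> 'rV[R]_n) x :
  u k @[k --> \oo] --> x <->
  forall e : R, 0 < e -> \forall k \near \oo, enorm (u k - x) < e.
Proof.
split=> [ux e e0|h A /nbhs_eballP[t t0 tA]]; first exact: (ux _ (eball_nbhs _ _ e0)).
by apply: filterS (h t t0) => k /= /tA.
Qed.

Lemma closure_enormP (A : set 'rV[R]_n) x :
  closure A x <-> forall e : R, 0 < e -> exists2 y, A y & enorm (y - x) < e.
Proof.
split=> [Ax e e0|h B /nbhs_eballP[t t0 tB]].
  by have [y [Ay xy]] := Ax _ (eball_nbhs _ _ e0); exists y.
by have [y Ay xy] := h t t0; exists y; split=> //; exact: tB.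
Qed.

(** Compactness of the cube $[-M,M]^n$. Cluster points with arbitrarily large indices take the place
    of subsequences in all compactness arguments below. *)
Lemma bounded_cluster (u : nat -> 'rV[R]_n) (M : R) :
  (forall k, enorm (u k) <= M) ->
  exists c, forall (e : R) N, 0 < e -> exists2 k, (N <= k)%N & enorm (u k - c) < e.
Proof.
move=> uM.
have box : compact [set v : 'rV[R]_n | forall i, `[- M, M]%classic (v ord0 i)].
  apply: (@rV_compact R n (fun=> `[- M, M]%classic)) => _.
  exact: segment_compact.
have ubox : (u @ \oo) [set v : 'rV[R]_n | forall i, `[- M, M]%classic (v ord0 i)].
  exists 0%N => // k _ i /=; rewrite in_itv/= -ler_norml.
  exact: le_trans (ler_norm_enorm _ _) (uM k).
have [c [_ cu]] := box _ _ ubox.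
exists c => e N e0.
have [|_ [[k /= Nk <-] ke]] :=
    cu (u @` [set k | (N <= k)%N]) _ _ (eball_nbhs c e e0).
  by exists N => //= k Nk; exists k.
by exists k.
Qed.

Lemma closure_eball0 t x : 0 < t -> closure (eball 0 t) x <-> enorm x <= t.
Proof.
move=> t0; split=> [/closure_enormP xt|xt].
  rewrite leNgt; apply/negP => tx.
  have [|y] := xt (enorm x - t); first by rewrite subr_gt0.
  rewrite /eball/= subr0 => yt.
  have := ler_enorm_dist y x 0; rewrite !subr0 enorm_distC; lra.
apply/closure_enormP => e e0.
have [xe|ex] := ltP (enorm x) e.
  by exists 0; rewrite ?sub0r ?enormN// /eball/= subr0 enorm0.
have x0 : 0 < enorm x by exact: lt_le_trans ex.
(* Shrinking [x] radially by [e / 2] keeps it within [e] and brings its norm strictly below [t]. *)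
exists ((1 - e / (2 * enorm x)) *: x).
  rewrite /eball/= subr0 enormZ ger0_norm; last first.
    by rewrite subr_ge0 ler_pdivrMr; lra.
  rewrite mulrBl mul1r (_ : _ / _ * _ = e / 2); first lra.
  by field; rewrite gt_eqF.
rewrite scalerBl scale1r addrAC subrr sub0r enormN enormZ ger0_norm; last first.
  by rewrite divr_ge0 ?mulr_ge0 ?(ltW e0) ?(ltW x0).
rewrite (_ : _ / _ * _ = e / 2); first lra.
by field; rewrite gt_eqF.
Qed.

End Euclidean.

Lemma exists_invSn_lt {R : realType} (e : R) : 0 < e ->
  exists N, forall k, (N <= k)%N -> k.+1%:R^-1 < e.
Proof. by move=> e0; have [N _ h] := near_infty_natSinv_lt (PosNum e0); exists N. Qed.

(** * Nearest points and positive reach *)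

Section Projection.
Context {R : realType} {n : nat} (E : set 'rV[R]_n).
Implicit Types (x y z p q u b : 'rV[R]_n) (s t h d e : R).

Definition nearest y p := E p /\ forall b, E b -> enorm (y - p) <= enorm (y - b).

Lemma edist_to_nearest y p :
  E p /\ edist_to E y = (enorm (p - y))%:E <-> nearest y p.
Proof.
split=> -[Ep h]; split=> //.
  move=> b Eb; rewrite -lee_fin enorm_distC -h.
  by apply: ereal_inf_lbound; exists b.
apply/le_anti/andP; split.
  by apply: ereal_inf_lbound; exists p => //; rewrite enorm_distC.
by apply: le_ereal_inf_tmp => _ [b Eb <-]; rewrite lee_fin enorm_distC h.
Qed.

(** The quantitative form in which positive reach enters the proof: one radius [s] serves all points
    of [E]. *)
Definition unique_nearest_within s :=
  forall a y, E a -> enorm (y - a) < s ->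
  exists p, nearest y p /\ forall q, nearest y q -> q = p.

Lemma positive_reach_nearest :
  positive_reach E -> exists2 s, 0 < s & unique_nearest_within s.
Proof.
move=> hE.
(* Strictly below the reach, so that each supremum [reach_at E a] is beaten by an admissible radius
   [r > s]. *)
have [s s0 sE] : exists2 s : R, 0 < s & (s%:E < reach E)%E.
  move: hE; rewrite /positive_reach; case: (reach E) => [r||]//.
    rewrite lte_fin => r0; exists (r / 2); rewrite ?lte_fin; lra.
  by exists 1; rewrite ?ltry.
exists s => // a y Ea ya.
have /ereal_sup_gt[_ [r [r0 rU] <-]] : (s%:E < reach_at E a)%E.
  by apply: lt_le_trans sE _; apply: ereal_inf_lbound; exists a.
rewrite lte_fin => sr.
have [p [/edist_to_nearest pn pu]] := rU y (lt_trans ya sr).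
by exists p; split=> // q /edist_to_nearest /pu.
Qed.

Context {s : R} (s_gt0 : 0 < s) (hU : unique_nearest_within s).

(** Such an [x] lies within [s] of [E], so it has a nearest point; the distance to it is smaller
    than every positive number, hence zero. *)
Lemma unique_nearest_closed x :
  (forall e : R, 0 < e -> exists2 y, E y & enorm (y - x) < e) -> E x.
Proof.
move=> hx; have [a Ea] := hx s s_gt0; rewrite enorm_distC => xa.
have [p [[Ep xp] _]] := hU a x Ea xa.
suff -> : x = p by [].
apply/eqP; rewrite -subr_eq0; apply: contraT => /enorm_gt0/hx[y Ey].
by rewrite enorm_distC ltNge xp.
Qed.

(** Otherwise some $z_k\to y$ have nearest points staying [e] away from [q]. These are bounded, and
    a cluster point of them is a nearest point of [y], hence equals [q]. *)
Lemma nearest_continuous y q (e : R) : nearest y q ->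
  (forall q', nearest y q' -> q' = q) -> 0 < e ->
  exists2 d : R, 0 < d &
    forall z q', enorm (z - y) < d -> nearest z q' -> enorm (q' - q) < e.
Proof.
move=> yq uq e0; apply: contrapT => hN.
have /choice[f fP] : forall k : nat, exists zq : 'rV[R]_n * 'rV[R]_n,
    [/\ enorm (zq.1 - y) < k.+1%:R^-1, nearest zq.1 zq.2
      & e <= enorm (zq.2 - q)].
  move=> k; apply: contrapT => hk; apply: hN; exists k.+1%:R^-1 => //.
  move=> z q' zy zq'; rewrite ltNge; apply/negP => eq'.
  by apply: hk; exists (z, q').
have [|c cP] := bounded_cluster (fun k => (f k).2)
    (1 + (1 + enorm (y - q)) + enorm y).
  move=> k /=; have [zy [_ zq] _] := fP k; have := zq q yq.1.
  have k1 : k.+1%:R^-1 <= 1 :> R by rewrite invf_le1 ?ler1n ?ltr0n.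
  have := ler_enorm_dist y (f k).1 q.
  have := ler_enorm_dist (f k).1 (f k).2 y.
  have := ler_enorm_dist y (f k).2 0; rewrite !subr0 (enorm_distC (f k).2 (f k).1).
  have := lt_le_trans zy k1; lra.
have Ec : E c.
  apply: unique_nearest_closed => d d0; have [k _ kc] := cP d 0%N d0.
  by exists (f k).2 => //; have [_ []] := fP k.
have /uq cq : nearest y c.
  split=> // b Eb; apply/ler_addgt0Pr => d d0.
  have d4 : 0 < d / 4 by lra.
  have [N NP] := exists_invSn_lt (d / 4) d4.
  have [k Nk kc] := cP (d / 4) N d4.
  have [zy [_ zq] _] := fP k; have := zq b Eb; have := lt_trans zy (NP k Nk).
  have := ler_enorm_dist (f k).1 y c.
  have := ler_enorm_dist (f k).2 (f k).1 c.
  have := ler_enorm_dist y (f k).1 b.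
  rewrite (enorm_distC y (f k).1); lra.
have [k _] := cP e 0%N e0; have [_ _] := fP k.
by rewrite cq; lra.
Qed.

(** A maximizing sequence clusters in the closed ball, and the distance to [E] is 1-Lipschitz. The
    bound by [s] gives every point of the ball a nearest point. *)
Lemma dist_max x p h : nearest x p -> 0 <= h -> enorm (x - p) + h < s ->
  exists y q, [/\ enorm (y - x) <= h, nearest y q &
    forall z q', enorm (z - x) <= h -> nearest z q' ->
      enorm (z - q') <= enorm (y - q)].
Proof.
move=> xp h0 hs.
have near z : enorm (z - x) <= h ->
    exists q, nearest z q /\ forall q', nearest z q' -> q' = q.
  move=> zx; apply: (hU p); first by case: xp.
  have := ler_enorm_dist x z p; lra.
pose D := [set d | exists z q, [/\ enorm (z - x) <= h, nearest z q & d = enorm (z - q)]].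
have Dub : has_ubound D.
  exists (enorm (x - p) + h) => _ [z [q [zx [_ zq] ->]]].
  have := zq p xp.1; have := ler_enorm_dist x z p; lra.
have D0 : D !=set0.
  by exists (enorm (x - p)), x, p; split=> //; rewrite subrr enorm0.
have /choice[f fP] : forall k : nat, exists zq : 'rV[R]_n * 'rV[R]_n,
    [/\ enorm (zq.1 - x) <= h, nearest zq.1 zq.2
      & sup D - k.+1%:R^-1 < enorm (zq.1 - zq.2)].
  move=> k; have k0 : 0 < k.+1%:R^-1 :> R by [].
  have [_ [z [q [zx zq ->]]] lt] := sup_adherent k0 (conj D0 Dub).
  by exists (z, q).
have [|y yP] := bounded_cluster (fun k => (f k).1) (h + enorm x).
  move=> k /=; have [+ _ _] := fP k.
  have := ler_enorm_dist x (f k).1 0; rewrite !subr0; lra.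
have yx : enorm (y - x) <= h.
  apply/ler_addgt0Pr => d d0; have [k _ ky] := yP d 0%N d0.
  have [zx _ _] := fP k; have := ler_enorm_dist (f k).1 y x.
  rewrite (enorm_distC y (f k).1); lra.
have [q [yq _]] := near y yx.
exists y, q; split=> // z q' zx zq'.
have zD : enorm (z - q') <= sup D by apply: ub_le_sup => //; exists z, q'.
apply/ler_addgt0Pr => d d0; have d2 : 0 < d / 2 by lra.
have [N NP] := exists_invSn_lt (d / 2) d2.
have [k Nk ky] := yP (d / 2) N d2.
have [_ [_ kq] kD] := fP k; have := kq q yq.1.
have := le_lt_trans (lerB (lexx (sup D)) (ltW (NP k Nk))) kD.
have := ler_enorm_dist y (f k).1 q; lra.
Qed.

(** For a unit vector [u] this is $|p+tu-b|^2\ge t^2$ expanded: [E] misses the open ball of radius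
    [t] centered at [p + t *: u]. Being linear in [t], the condition passes to smaller radii. *)
Definition prox p u t := forall b, E b -> 2 * t * dotv (b - p) u <= enorm (b - p) ^+ 2.

Lemma prox_nearest p u t : E p -> enorm u = 1 -> 0 <= t ->
  prox p u t <-> nearest (p + t *: u) p.
Proof.
move=> Ep u1 t0.
have e1 b : enorm (p + t *: u - b) ^+ 2 =
    enorm (b - p) ^+ 2 - 2 * t * dotv (b - p) u + t ^+ 2.
  have uu : dotv u u = 1 by rewrite -sqr_enorm u1 expr1n.
  rewrite !sqr_enorm !dotvE uu (dotvC u p) (dotvC u b) (dotvC b p); ring.
have e2 : enorm (p + t *: u - p) = t.
  by rewrite addrAC subrr add0r enormZ u1 mulr1 ger0_norm.
split=> [hp|[_ hp] b Eb].
  split=> // b Eb; rewrite e2 -(@ler_pXn2r _ 2) ?nnegrE ?enorm_ge0// e1.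
  have := hp b Eb; lra.
have := hp b Eb; rewrite e2 -(@ler_pXn2r _ 2) ?nnegrE ?enorm_ge0// e1; lra.
Qed.

Lemma prox_le p u t t' : 0 <= t' -> t' <= t -> prox p u t -> prox p u t'.
Proof.
move=> t0 tt hp b Eb; have [d0|/ltW d0] := leP (dotv (b - p) u) 0.
  by apply: (@le_trans _ _ 0); [nra|exact: sqr_ge0].
by apply: le_trans (hp b Eb); nra.
Qed.

End Projection.

(** * Prolonging normal segments up to length s *)

Section Reach.
Context {R : realType} {n : nat} {E : set 'rV[R]_n} {s : R}.
Hypotheses (s_gt0 : 0 < s) (hU : unique_nearest_within E s).
Implicit Types (x y z p q u b : 'rV[R]_n) (t h : R).

(** First order condition at a maximum: if it failed, moving [y] slightly along [e], the difference
    of the unit vector from [q] to [y] and of [(y - x) / h], would stay in the ball and increase the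
    distance to [E]. *)
Lemma dist_max_dotv x p y q h : 0 < h -> enorm (x - p) + h < s -> E p ->
  nearest E y q -> y != q -> enorm (y - x) <= h ->
  (forall z q', enorm (z - x) <= h -> nearest E z q' ->
    enorm (z - q') <= enorm (y - q)) ->
  h * enorm (y - q) <= dotv (y - x) (y - q).
Proof.
move=> h0 hs Ep yq yNq yx ymax; rewrite leNgt; apply/negP => lt.
have near z : enorm (z - x) <= h ->
    exists q, nearest E z q /\ forall q', nearest E z q' -> q' = q.
  move=> zx; apply: (hU p) => //.
  have := ler_enorm_dist x z p; lra.
have D0 : 0 < enorm (y - q) by rewrite enorm_gt0 ?subr_eq0.
set D := enorm (y - q) in D0 lt.
pose e := D^-1 *: (y - q) - h^-1 *: (y - x).
pose c := dotv e (y - q).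
have c0 : 0 < c.
  rewrite /c /e dotvBl !dotvZl -sqr_enorm -/D expr2 mulKf ?gt_eqF// subr_gt0.
  by rewrite mulrC ltr_pdivrMr// mulrC.
have e0 : 0 < enorm e + 1 by rewrite ltr_wpDl ?enorm_ge0.
have uq q' : nearest E y q' -> q' = q.
  have [q0 [_ u0]] := near y yx => yq'.
  by rewrite (u0 _ yq) (u0 _ yq').
(* The moved point has its own nearest point [q']; within [d] of [y] it satisfies
   [dotv e (q' - q) < c], so [e] still points away from [q']. *)
have [d d0 dP] := nearest_continuous E s_gt0 hU y q _ yq uq (divr_gt0 c0 e0).
pose t := Num.min h (d / (2 * (enorm e + 1))).
have t0 : 0 < t by rewrite lt_min h0 divr_gt0 ?mulr_gt0.
have th : t <= h by rewrite ge_min lexx.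
have td : t * enorm e < d.
  have : t <= d / (2 * (enorm e + 1)) by rewrite ge_min lexx orbT.
  rewrite ler_pdivlMr ?mulr_gt0//; have := enorm_ge0 e; nra.
have zx : enorm (y + t *: e - x) <= h.
  (* The two terms have norms at most [h - t] and [t]. *)
  have -> : y + t *: e - x = (1 - t / h) *: (y - x) + (t / D) *: (y - q).
    apply/rowP => i; rewrite !mxE; field; by rewrite !gt_eqF.
  apply: le_trans (ler_enormD _ _) _; rewrite !enormZ.
  rewrite !ger0_norm ?divr_ge0 ?(ltW t0) ?(ltW D0)// ?subr_ge0 ?ler_pdivrMr ?mul1r//.
  rewrite -/D divfK ?gt_eqF//.
  apply: (@le_trans _ _ ((1 - t / h) * h + t)).
    by rewrite lerD2r ler_wpM2l// subr_ge0 ler_pdivrMr ?mul1r.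
  by rewrite mulrBl mul1r divfK ?gt_eqF// subrK.
have [q' [zq' _]] := near _ zx.
have zy : enorm (y + t *: e - y) < d.
  by rewrite addrAC subrr add0r enormZ gtr0_norm.
have q'q := dP _ _ zy zq'.
have := ymax _ _ zx zq'.
apply/negP; rewrite -ltNge -/D -(@ltr_pXn2r _ 2) ?nnegrE ?enorm_ge0 ?ltW//.
have yq' : D ^+ 2 <= enorm (y - q') ^+ 2.
  by rewrite ler_pXn2r ?nnegrE ?enorm_ge0//; apply: yq.2; case: zq'.
apply: le_lt_trans yq' _.
have -> : y + t *: e - q' = (y - q') + t *: e by rewrite addrAC.
rewrite [X in _ < X]sqr_enormD dotvZr (dotvC (y - q')).
have -> : dotv e (y - q') = c - dotv e (q' - q).
  by rewrite /c -dotvBr; congr dotv; rewrite opprB addrA subrK.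
have : dotv e (q' - q) < c.
  apply: le_lt_trans (le_dotv _ _) _.
  move: q'q; rewrite ltr_pdivlMr//.
  have := enorm_ge0 e; have := enorm_ge0 (q' - q); nra.
rewrite -subr_gt0 => /(mulr_gt0 t0) ec.
have := sqr_ge0 (enorm (t *: e)); lra.
Qed.

(* At a maximum [y] of the distance to [E] over the ball of radius [h] around
   [x], the first order condition forces [x] onto the segment from [y] to its
   nearest point, which is thus the nearest point of [x]. *)
Lemma prox_extend p u t h : E p -> enorm u = 1 -> 0 < h -> h <= t -> t + h < s ->
  prox E p u t -> prox E p u (t + h).
Proof.
move=> Ep u1 h0 ht ths pt; have t0 : 0 < t by exact: lt_le_trans ht.
set x := p + t *: u.
have xp : nearest E x p by apply/prox_nearest => //; exact: ltW.
have xpt : enorm (x - p) = t.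
  by rewrite /x addrAC subrr add0r enormZ u1 mulr1 gtr0_norm.
have [||y [q [yx yq ymax]]] := dist_max E hU x p h xp; rewrite ?ltW ?xpt//.
have tD : t <= enorm (y - q).
  by rewrite -xpt; apply: ymax => //; rewrite subrr enorm0 ltW.
have D0 : 0 < enorm (y - q) by exact: lt_le_trans tD.
have yNq : y != q.
  by apply: contraTneq D0 => ->; rewrite subrr enorm0 ltxx.
have := @dist_max_dotv x p y q h h0; rewrite xpt => /(_ ths Ep yq yNq yx ymax).
set D := enorm (y - q) in tD D0 *; move=> gw.
(* Equality case of Cauchy-Schwarz: since [enorm (y - x) <= h], the bound [gw] makes the squared
   norm of the difference nonpositive. *)
have yE : D *: (y - x) = h *: (y - q).
  apply/eqP; rewrite -subr_eq0; apply/eqP; apply: enorm_eq0.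
  apply/eqP; rewrite -sqrf_eq0 eq_le sqr_ge0 andbT sqr_enorm.
  rewrite !(dotvBl (D *: _)) !(dotvBr _ (D *: _)) !(dotvZl, dotvZr).
  rewrite (dotvC (y - q) (y - x)) -!sqr_enorm -/D.
  have g2 : enorm (y - x) ^+ 2 <= h ^+ 2.
    by rewrite ler_pXn2r ?nnegrE ?enorm_ge0// ltW.
  have : D ^+ 2 * enorm (y - x) ^+ 2 <= D ^+ 2 * h ^+ 2.
    by rewrite ler_wpM2l// sqr_ge0.
  have : h * D * (h * D) <= h * D * dotv (y - x) (y - q).
    by rewrite ler_wpM2l// mulr_ge0// ltW.
  nra.
pose v := D^-1 *: (y - q).
have v1 : enorm v = 1 by rewrite /v enormZ gtr0_norm ?invr_gt0// mulVf ?gt_eqF.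
have qv : y = q + D *: v by rewrite /v scalerA divff ?gt_eqF// scale1r subrKC.
have xq : x = q + (D - h) *: v.
  have : y - x = h *: v.
    by rewrite /v scalerA mulrC -scalerA -yE scalerA mulVf ?gt_eqF// scale1r.
  move=> yx'; rewrite scalerBl addrA -qv -yx'; by rewrite opprB subrKC.
(* Here [h <= t <= D] places [x] between [q] and [y]. *)
have Dh0 : 0 <= D - h by lra.
have Eq : E q by case: yq.
have pD : prox E q v D by apply/prox_nearest; rewrite -?qv // ltW.
have qp : q = p.
  have [q0 [_ u0]] : exists q, nearest E x q /\ forall q', nearest E x q' -> q' = q.
    by apply: (hU p) => //; rewrite xpt; lra.
  rewrite (u0 p xp); apply: u0; rewrite xq.
  by apply/prox_nearest => //; apply: prox_le pD; lra.
have tv : t *: u = (D - h) *: v.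
  by apply: (addrI p); rewrite -/x xq qp.
have Dht : D - h = t.
  have := congr1 (@enorm R n) tv; rewrite enormZ u1 enormZ v1 !mulr1 !ger0_norm//.
  by rewrite ltW.
have uv : u = v.
  by move: tv; rewrite Dht; apply: scalerI; rewrite gt_eqF.
by rewrite uv -qp (_ : t + h = D)// -Dht subrK.
Qed.

(** [prox_extend] can at most double the radius, so the induction is on the number of doublings
    needed to reach [t']. *)
Lemma prox_lt p u t t' : E p -> enorm u = 1 -> 0 < t -> 0 <= t' -> t' < s ->
  prox E p u t -> prox E p u t'.
Proof.
move=> Ep u1 t0 t'0 t's pt.
have [k kP] : exists k : nat, t' <= 2 ^+ k * t.
  have := ltW (truncnS_gt (t' / t)); set N := (_.+1)%N.
  rewrite ler_pdivrMr// => tN; exists N; apply: le_trans tN _.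
  by rewrite ler_pM2r// -natrX ler_nat ltnW// ltn_expl.
elim: k t t0 pt kP => [t t0 pt|k IH t t0 pt].
  rewrite expr0 mul1r => tt; exact: prox_le pt.
have [tt _|tt kP] := leP t' t; first exact: prox_le pt.
have [t2|t2] := leP t' (2 * t).
  rewrite -(subrKC t t'); apply: prox_extend => //; lra.
apply: (IH (t + t)); [lra| |by move: kP; rewrite exprS; lra].
by apply: prox_extend => //; lra.
Qed.

(** This is [prox] at radius [s / 2] in the unit direction from [p] to [x], obtained from [prox_lt]
    and multiplied by [enorm (x - p)]. *)
Lemma nearest_prox x p : nearest E x p -> enorm (x - p) < s ->
  forall b, E b ->
  s * dotv (b - p) (x - p) <= enorm (b - p) ^+ 2 * enorm (x - p).
Proof.
move=> xp xs b Eb; have Ep : E p by case: xp.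
have [->|xNp] := eqVneq x p.
  by rewrite subrr enorm0 mulr0 -(scale0r (0 : 'rV[R]_n)) dotvZr mul0r mulr0.
have D0 : 0 < enorm (x - p) by rewrite enorm_gt0 ?subr_eq0.
pose u := (enorm (x - p))^-1 *: (x - p).
have u1 : enorm u = 1.
  by rewrite /u enormZ gtr0_norm ?invr_gt0// mulVf ?gt_eqF.
have pu : prox E p u (enorm (x - p)).
  apply/prox_nearest; rewrite ?enorm_ge0//.
  by rewrite /u scalerA divff ?gt_eqF// scale1r subrKC.
have s2 : 0 <= s / 2 by lra.
have s2s : s / 2 < s by lra.
have := prox_lt p u _ _ Ep u1 D0 s2 s2s pu b Eb.
rewrite mulrC [X in _ * X]mulrC divfK ?pnatr_eq0// mulrC /u dotvZr mulrCA.
by rewrite mulrC ler_pdivrMr.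
Qed.

End Reach.

(** * Tangent directions *)

Section TangentDirections.
Context {R : realType} {n : nat}.
Implicit Types (E : set 'rV[R]_n) (x v w b : 'rV[R]_n) (e t r : R).

(** Unit tangent vectors, free of sequences and division; a single [e] bounds both the distance to
    [x] and the relative error in direction. *)
Definition tangent_dir E x v := enorm v = 1 /\
  forall e, 0 < e -> exists b, [/\ E b, 0 < enorm (b - x), enorm (b - x) < e &
    enorm (b - x - enorm (b - x) *: v) <= e * enorm (b - x)].

Lemma enorm_normalize x : x != 0 -> enorm ((enorm x)^-1 *: x) = 1.
Proof.
move=> /enorm_gt0 x0.
by rewrite enormZ gtr0_norm ?invr_gt0// mulVf ?gt_eqF.
Qed.

Lemma enorm_direction_error x v : x != 0 ->
  enorm (x - enorm x *: v) = enorm x * enorm ((enorm x)^-1 *: x - v).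
Proof.
move=> /enorm_gt0 x0; rewrite -[X in X * _]gtr0_norm// -enormZ scalerBr.
by rewrite scalerA divff ?gt_eqF// scale1r.
Qed.

Lemma tangent_dir_Tan E x v r : 0 <= r -> tangent_dir E x v -> Tan E x (r *: v).
Proof.
move=> r0 [v1 vP]; right; split.
  move=> U /nbhs_eballP[e e0 eU]; have [b [Eb bx be _]] := vP e e0.
  exists b; split => //; last exact: eU.
  by apply: contraTneq bx => ->; rewrite subrr enorm0 ltxx.
have /choice[u uP] : forall k : nat, exists b, [/\ E b, 0 < enorm (b - x),
    enorm (b - x) < k.+1%:R^-1 &
    enorm (b - x - enorm (b - x) *: v) <= k.+1%:R^-1 * enorm (b - x)].
  by move=> k; exact: vP.
have ux k : u k - x != 0.
  by have [_ + _ _] := uP k; apply: contraTneq => ->; rewrite enorm0 ltxx.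
exists r, v, u; split => //.
- move=> k; split; first by have [] := uP k.
  by move=> ukx; have := ux k; rewrite ukx subrr eqxx.
- apply/cvg_enormP => e e0; have [N NP] := exists_invSn_lt e e0.
  exists N => // k /= /NP; apply: lt_trans; by have [] := uP k.
- apply/cvg_enormP => e e0; have [N NP] := exists_invSn_lt e e0.
  exists N => // k /= /NP; apply: le_lt_trans; have [_ uk _] := uP k.
  by rewrite enorm_direction_error// mulrC ler_pM2r.
Qed.

Lemma Tan_tangent_dir E x w : Tan E x w ->
  w = 0 \/ exists v, tangent_dir E x v /\ w = enorm w *: v.
Proof.
move=> [[_ ->]|[_ [r [v [u [r0 uE /cvg_enormP ux /cvg_enormP uv ->]]]]]]; first by left.
right; exists v.
have uxN k : u k - x != 0 by rewrite subr_eq0; apply/eqP; case: (uE k).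
have v1 : enorm v = 1.
  apply/eqP; rewrite -subr_eq0 -normr_le0; apply/ler_addgt0Pr => e e0.
  have [N _ /(_ N (leqnn N)) /= uN] := uv e e0.
  have := ler_enorm_dist v ((enorm (u N - x))^-1 *: (u N - x)) 0.
  have := ler_enorm_dist ((enorm (u N - x))^-1 *: (u N - x)) v 0.
  rewrite !subr0 enorm_normalize// add0r (enorm_distC v) ler_norml; lra.
split; last by rewrite enormZ v1 mulr1 ger0_norm.
split => // e e0.
have [N1 _ h1] := ux e e0; have [N2 _ h2] := uv e e0.
exists (u (maxn N1 N2)); split.
- by case: (uE (maxn N1 N2)).
- exact: enorm_gt0.
- by apply: h1 => /=; rewrite leq_maxl.
- rewrite enorm_direction_error// mulrC ler_pM2r ?enorm_gt0//.
  by apply: ltW; apply: h2 => /=; rewrite leq_maxr.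
Qed.

(** Otherwise points of [E] tending to [x] would keep away from every tangent direction, yet a
    cluster point of their normalized differences is one. *)
Lemma tangent_dir_uniform E x e : 0 < e -> exists2 r, 0 < r &
  forall b, E b -> 0 < enorm (b - x) -> enorm (b - x) <= r ->
  exists2 v, tangent_dir E x v &
    enorm (b - x - enorm (b - x) *: v) <= e * enorm (b - x).
Proof.
move=> e0; apply: contrapT => hN.
have /choice[u uP] : forall k : nat, exists b, [/\ E b, 0 < enorm (b - x),
    enorm (b - x) <= k.+1%:R^-1 & forall v, tangent_dir E x v ->
    ~ enorm (b - x - enorm (b - x) *: v) <= e * enorm (b - x)].
  move=> k; apply: contrapT => hk; apply: hN; exists k.+1%:R^-1 => //.
  move=> b Eb b0 bk; apply: contrapT => hv; apply: hk; exists b.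
  by split=> // v vT vb; apply: hv; exists v.
have ux k : u k - x != 0.
  by have [_ + _ _] := uP k; apply: contraTneq => ->; rewrite enorm0 ltxx.
have [|v vP] := bounded_cluster (fun k => (enorm (u k - x))^-1 *: (u k - x)) 1.
  by move=> k; rewrite /= enorm_normalize.
have vT : tangent_dir E x v.
  split.
    apply/eqP; rewrite -subr_eq0 -normr_le0; apply/ler_addgt0Pr => d d0.
    have [N _ /= uN] := vP d 0%N d0.
    have := ler_enorm_dist v ((enorm (u N - x))^-1 *: (u N - x)) 0.
    have := ler_enorm_dist ((enorm (u N - x))^-1 *: (u N - x)) v 0.
    rewrite !subr0 enorm_normalize// add0r (enorm_distC v) ler_norml; lra.
  move=> d d0; have [N NP] := exists_invSn_lt d d0.
  have [k Nk /= uk] := vP d N d0; have [Eu u0 ukx _] := uP k.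
  exists (u k); split => //; first exact: le_lt_trans ukx (NP k Nk).
  by rewrite enorm_direction_error// mulrC ler_pM2r// ltW.
have [k _ /= uk] := vP e 0%N e0; have [_ u0 _ /(_ v vT)] := uP k; apply.
by rewrite enorm_direction_error// mulrC ler_pM2r// ltW.
Qed.

(** Either a small punctured ball misses [E] and [x] is isolated, or some tangent direction exists
    and is scaled by 0. *)
Lemma Tan0 E x : E x -> Tan E x 0.
Proof.
move=> Ex; have [r r0 rP] := tangent_dir_uniform E x 1 ltr01.
have [[b [Eb bx br]]|hN] := pselect (exists b, [/\ E b,
     0 < enorm (b - x) & enorm (b - x) <= r]).
  have [v vT _] := rP b Eb bx br.
  by rewrite -(scale0r v); exact: tangent_dir_Tan.
left; split => //; split; first exact: mem_set.
exists (eball x r); first exact: eball_nbhs.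
apply/seteqP; split => [b [/= bx Eb]|_ ->]; last first.
  by split => //; rewrite /eball/= subrr enorm0.
apply/eqP; rewrite -subr_eq0; apply: contraT => /enorm_gt0 b0.
by case: hN; exists b; split => //; exact: ltW.
Qed.

(** * Sets of positive reach follow their tangent rays *)

Context {E : set 'rV[R]_n} {s : R}.
Hypotheses (s_gt0 : 0 < s) (hU : unique_nearest_within E s).

(* The inequality [nearest_prox] at [b] bounds the component of [v] along
   [x + t *: v - p], the one at [x] then bounds the distance itself. *)
Lemma dist_ray_le x b v r e t : E x -> E b -> enorm v = 1 -> e <= 1 ->
  enorm (b - x - r *: v) <= e * r -> 0 < t -> 2 * t <= r -> t < s ->
  exists2 p, E p & s * enorm (x + t *: v - p) <= t * (2 * e * s + 20 * r).
Proof.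
move=> Ex Eb v1 e1 bv t0 tr ts.
set y := x + t *: v.
have yx : enorm (y - x) = t.
  by rewrite /y addrAC subrr add0r enormZ v1 mulr1 gtr0_norm.
have [p [yp _]] : exists p, nearest E y p /\ forall q, nearest E y q -> q = p.
  by apply: (hU x) => //; rewrite yx.
exists p; first by case: yp.
set d := enorm (y - p).
have dt : d <= t by rewrite -yx; apply: yp.2.
have d0 : 0 <= d by exact: enorm_ge0.
have ds : d < s by lra.
have e0 : 0 <= e by have := enorm_ge0 (b - x - r *: v); nra.
have hx := nearest_prox s_gt0 hU y p yp ds x Ex.
have hb := nearest_prox s_gt0 hU y p yp ds b Eb.
rewrite -/d in hx hb.
have xp : enorm (x - p) <= 2 * t.
  by have := ler_enorm_dist y x p; rewrite (enorm_distC x y) yx -/d; lra.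
(* The three summands are [e * r], [2 * t] and [r], each at most [r]. *)
have bp : enorm (b - p) <= 3 * r.
  have -> : b - p = (b - x - r *: v) + ((x - p) + r *: v).
    by apply/rowP => i; rewrite !mxE; ring.
  have := ler_enormD (b - x - r *: v) ((x - p) + r *: v).
  have := ler_enormD (x - p) (r *: v).
  rewrite enormZ v1 mulr1 ger0_norm; last lra.
  nra.
pose A := dotv (x - p) (y - p); pose V := dotv v (y - p).
have dE : d ^+ 2 = A + t * V.
  rewrite /d sqr_enorm -dotvZl -dotvDl; congr dotv.
  by rewrite /y addrAC.
have bE : dotv (b - p) (y - p) = dotv (b - x - r *: v) (y - p) + A + r * V.
  rewrite -dotvZl -!dotvDl; congr dotv.
  by apply/rowP => i; rewrite !mxE; ring.
have g : - (e * r * d) <= dotv (b - x - r *: v) (y - p).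
  rewrite lerNl -dotvNl; apply: le_trans (le_dotv _ _) _.
  by rewrite enormN -/d ler_wpM2r.
have xp2 : enorm (x - p) ^+ 2 <= (2 * t) ^+ 2.
  by rewrite ler_pXn2r ?nnegrE ?enorm_ge0//; lra.
have bp2 : enorm (b - p) ^+ 2 <= (3 * r) ^+ 2.
  by rewrite ler_pXn2r ?nnegrE ?enorm_ge0//; lra.
have hx' : s * A <= (2 * t) ^+ 2 * d.
  by apply: le_trans hx _; rewrite ler_wpM2r.
have hb' : s * (A + r * V) <= (9 * r ^+ 2 + s * (e * r)) * d.
  have : s * dotv (b - p) (y - p) <= (3 * r) ^+ 2 * d.
    by apply: le_trans hb _; rewrite ler_wpM2r.
  have : s * - (e * r * d) <= s * dotv (b - x - r *: v) (y - p).
    by rewrite ler_pM2l.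
  rewrite bE; nra.
have [->|dN0] := eqVneq d 0.
  by rewrite mulr0 mulr_ge0 ?addr_ge0 ?mulr_ge0//; lra.
have {dN0} d1 : 0 < d by rewrite lt_neqAle eq_sym dN0.
rewrite -(ler_pM2r d1).
rewrite -(mulrA s d d) -expr2 dE mulrDr.
(* By [dE] the goal bounds $sA+stV$. If $V\le0$, the bound $sA\le4t^2d$ is enough. *)
have [V0|V0] := leP V 0.
  have h1 : s * (t * V) <= 0 by rewrite pmulr_rle0// pmulr_rle0.
  have h2 : (2 * t) ^+ 2 <= t * (2 * e * s + 20 * r).
    have : 0 <= e * s by rewrite mulr_ge0// ltW.
    nra.
  have := ler_wpM2r d0 h2; lra.
(* From $A+tV=d^2\ge0$ and $t\le r/2$ comes $A+rV\ge rV/2$, so [hb'] bounds [V]. The final 20 is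
   this 18 plus the 2 from $4t^2\le2tr$. *)
have hV : s * V <= (18 * r + 2 * s * e) * d.
  have A0 : - (t * V) <= A by have := sqr_ge0 d; lra.
  have h3 : s * (r / 2 * V) <= s * (A + r * V).
    rewrite ler_pM2l//; nra.
  have r0 : 0 < r / 2 by lra.
  rewrite -(ler_pM2l r0); lra.
have h4 : s * (t * V) <= t * ((18 * r + 2 * s * e) * d).
  by rewrite mulrCA ler_pM2l.
have h5 : 4 * t ^+ 2 * d <= t * (2 * r) * d.
  by rewrite ler_wpM2r// expr2 mulrCA ler_pM2l//; lra.
lra.
Qed.

Lemma tangent_ray_close x v e : E x -> tangent_dir E x v -> 0 < e ->
  exists2 r, 0 < r & forall t, 0 < t -> t <= r ->
    exists2 p, E p & enorm (x + t *: v - p) <= e * t.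
Proof.
move=> Ex [v1 vP] e0.
(* In the bound of [dist_ray_le], [e / 4] and [e * s / 40] make each of the two terms at most
   [e * s / 2]; 1 and [s] secure its hypotheses. *)
pose d := Num.min (Num.min 1 (e / 4)) (Num.min s (e * s / 40)).
have d0 : 0 < d by rewrite !lt_min ltr01 s_gt0 !divr_gt0 ?mulr_gt0.
have [d1 d2 d3 d4] : [/\ d <= 1, d <= e / 4, d <= s & d <= e * s / 40].
  by split; rewrite !ge_min lexx ?orbT.
have [b [Eb bx bd bv]] := vP d d0.
exists (enorm (b - x) / 2) => [|t t0 tb]; first by rewrite divr_gt0.
have [||p Ep hp] := dist_ray_le x b v (enorm (b - x)) d t Ex Eb v1 d1 bv t0; [lra|lra|].
exists p => //; rewrite -(ler_pM2l s_gt0); apply: le_trans hp _.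
have : d * s <= e / 4 * s by rewrite ler_pM2r.
rewrite (_ : s * (e * t) = t * (e * s)); last ring.
rewrite ler_pM2l//; lra.
Qed.

Lemma tangent_ray_close_uniform x e : E x -> 0 < e ->
  exists2 r, 0 < r & forall v t, tangent_dir E x v -> 0 < t -> t <= r ->
    exists2 p, E p & enorm (x + t *: v - p) <= e * t.
Proof.
move=> Ex e0; apply: contrapT => hN.
have /choice[f fP] : forall k : nat, exists vt : 'rV[R]_n * R,
    [/\ tangent_dir E x vt.1, 0 < vt.2, vt.2 <= k.+1%:R^-1 &
      forall p, E p -> ~ enorm (x + vt.2 *: vt.1 - p) <= e * vt.2].
  move=> k; apply: contrapT => hk; apply: hN; exists k.+1%:R^-1 => //.
  move=> v t vT t0 tk; apply: contrapT => hp; apply: hk; exists (v, t).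
  by split => // p Ep pv; apply: hp; exists p.
have [|v vP] := bounded_cluster (fun k => (f k).1) 1.
  by move=> k /=; have [[-> _]] := fP k.
have e4 : 0 < e / 4 by lra.
have e2 : 0 < e / 2 by lra.
(* The cluster point is replaced by a nearby term of the sequence, already known to be a tangent
   direction; later directions clustering there differ from it by at most [e / 2]. *)
have [K _ /= vK] := vP (e / 4) 0%N e4.
have [KT _ _ _] := fP K.
have [r r0 rP] := tangent_ray_close x (f K).1 (e / 2) Ex KT e2.
have [N NP] := exists_invSn_lt r r0.
have [k Nk /= vk] := vP (e / 4) N e4.
have [_ t0 tk hk] := fP k.
have [p Ep hp] := rP (f k).2 t0 (ltW (le_lt_trans tk (NP k Nk))).
apply: (hk p Ep).
have -> : x + (f k).2 *: (f k).1 - p =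
    (f k).2 *: ((f k).1 - (f K).1) + (x + (f k).2 *: (f K).1 - p).
  by apply/rowP => i; rewrite !mxE; ring.
apply: le_trans (ler_enormD _ _) _; rewrite enormZ gtr0_norm//.
have kK : enorm ((f k).1 - (f K).1) <= e / 2.
  have := ler_enorm_dist v (f k).1 (f K).1; rewrite (enorm_distC v); lra.
have : (f k).2 * enorm ((f k).1 - (f K).1) <= (f k).2 * (e / 2).
  by rewrite ler_pM2l.
lra.
Qed.

End TangentDirections.

(** * Hausdorff convergence *)

Section HausdorffDistance.
Context {R : realType} {n : nat}.
Implicit Types (A B : set 'rV[R]_n) (e : R).

Lemma thickening_le A e x y : A y -> enorm (x - y) <= e -> thickening A e x.
Proof.
move=> Ay xy; apply: (@le_trans _ _ (enorm (x - y))%:E).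
  by apply: ereal_inf_lbound; exists y.
by rewrite lee_fin.
Qed.

Lemma hausdorff_dist_ge0 A B : (0 <= hausdorff_dist A B)%E.
Proof. by apply: le_ereal_inf_tmp => _ [t [t0 _ _] <-]; rewrite lee_fin ltW. Qed.

Lemma hausdorff_dist_le A B e : 0 < e ->
  (forall x, A x -> exists2 y, B y & enorm (x - y) <= e) ->
  (forall y, B y -> exists2 x, A x & enorm (y - x) <= e) ->
  (hausdorff_dist A B <= e%:E)%E.
Proof.
move=> e0 AB BA; apply: ereal_inf_lbound; exists e => //; split => //.
  by move=> y /BA[x Ax yx]; exact: thickening_le yx.
by move=> x /AB[y By xy]; exact: thickening_le xy.
Qed.

End HausdorffDistance.

Lemma cvge0_near_le {R : realType} {T : Type} (F : set_system T) {FF : Filter F}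
    (f : T -> \bar R) :
  (forall x, 0 <= f x)%E ->
  (forall e : R, 0 < e -> \forall x \near F, (f x <= e%:E)%E) ->
  f x @[x --> F] --> 0%E.
Proof.
move=> f0 fe; apply/fine_cvgP; split.
  apply: filterS (fe 1 ltr01) => x fx.
  by rewrite ge0_fin_numE// (le_lt_trans fx) ?ltry.
apply/cvgrPdist_le => e e0; apply: filterS (fe e e0) => x /=.
by have := f0 x; case: (f x) => [r||]//=; rewrite !lee_fin => r0;
   rewrite sub0r normrN ger0_norm.
Qed.

Theorem theorem3p3 (R : realType) (n : nat) (hn : (2 <= n)%N)
    (E : set 'rV[R]_n) (hE : positive_reach E)
    (x0 : 'rV[R]_n) (hx0 : boundary E x0) (r : R) (hr : 0 < r) :
  hausdorff_dist (blowup E x0 rho `&` closure (eball 0 r))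
                 (Tan E x0 `&` closure (eball 0 r)) @[rho --> 0^'+] --> 0%E.
Proof.
have [s s0 hU] := positive_reach_nearest E hE.
have Ex : E x0.
  apply: (unique_nearest_closed E s0 hU).
  by case: hx0 => /closure_enormP.
apply: cvge0_near_le => [rho|e e0]; first exact: hausdorff_dist_ge0.
(* At scales up to [rho * r], this relative error becomes at most [e / 2] after division by
   [rho]. *)
have e1 : 0 < e / (2 * r) by rewrite divr_gt0 ?mulr_gt0.
have er : e / (2 * r) * r = e / 2 by field; rewrite gt_eqF.
have [r1 r10 close1] := tangent_dir_uniform E x0 _ e1.
have [r2 r20 close2] := tangent_ray_close_uniform s0 hU x0 _ Ex e1.
near=> rho.
have rho0 : 0 < rho by near: rho; exact: nbhs_right_gt.
have rhor1 : rho * r <= r1.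
  rewrite -ler_pdivlMr//; near: rho; apply: nbhs_right_le.
  by rewrite divr_gt0.
have rhor2 : rho * r <= r2.
  rewrite -ler_pdivlMr//; near: rho; apply: nbhs_right_le.
  by rewrite divr_gt0.
apply: hausdorff_dist_le => // [_ [[b Eb <-]]|w [wT]].
  move/(closure_eball0 r _ hr); rewrite enormZ gtr0_norm ?invr_gt0//.
  rewrite ler_pdivrMl// => br.
  have [->|bNx] := eqVneq b x0.
    exists 0; last by rewrite subrr scaler0 subr0 enorm0 ltW.
    by split; [exact: Tan0|apply/closure_eball0 => //; rewrite enorm0 ltW].
  have bx : 0 < enorm (b - x0) by rewrite enorm_gt0 ?subr_eq0.
  have [v vT bv] := close1 b Eb bx (le_trans br rhor1).
  have c0 : 0 <= rho^-1 * enorm (b - x0) by rewrite mulr_ge0 ?enorm_ge0 ?invr_ge0// ltW.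
  (* The tangent vector has the norm of the blown-up point, so it stays in the closed ball. *)
  exists ((rho^-1 * enorm (b - x0)) *: v).
    split; first exact: tangent_dir_Tan.
    apply/closure_eball0 => //; case: vT => v1 _.
    by rewrite enormZ v1 mulr1 ger0_norm ?ler_pdivrMl.
  rewrite -scalerA -scalerBr enormZ gtr0_norm ?invr_gt0// ler_pdivrMl//.
  apply: le_trans bv _.
  have : e / (2 * r) * enorm (b - x0) <= e / (2 * r) * (rho * r).
    by rewrite ler_pM2l.
  have : 0 < rho * e by exact: mulr_gt0.
  by rewrite (mulrC rho r) mulrA er; lra.
move/(closure_eball0 r _ hr) => wr.
(* Short vectors are approximated by the origin, the image of [x0]. *)
have [we|we] := leP (enorm w) e.
  exists 0; last by rewrite subr0.
  split; last by apply/closure_eball0 => //; rewrite enorm0 ltW.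
  by exists x0 => //; rewrite subrr scaler0.
have w0 : 0 < enorm w by exact: lt_trans we.
have [wz|[v [vT wE]]] := Tan_tangent_dir _ _ _ wT.
  by rewrite wz enorm0 ltxx in w0.
(* Shortening [w] by [e / 2] leaves room for the approximating point to stay in
   the closed ball of radius [r]. *)
pose m := enorm w - e / 2.
have m0 : 0 < m by rewrite /m; lra.
have mr : m <= r by rewrite /m; lra.
have t0 : 0 < rho * m by exact: mulr_gt0.
have tr : rho * m <= r2 by apply: le_trans rhor2; rewrite ler_pM2l.
have [p Ep hp] := close2 v (rho * m) vT t0 tr.
have pm : enorm (rho^-1 *: (p - x0) - m *: v) <= e / 2.
  have -> : rho^-1 *: (p - x0) - m *: v = - (rho^-1 *: (x0 + (rho * m) *: v - p)).
    by apply/rowP => i; rewrite !mxE; field; rewrite gt_eqF.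
  rewrite enormN enormZ gtr0_norm ?invr_gt0// ler_pdivrMl//.
  apply: le_trans hp _; rewrite mulrCA ler_pM2l// -er ler_pM2l//.
have v1 := vT.1.
exists (rho^-1 *: (p - x0)).
  split; first by exists p.
  apply/closure_eball0 => //.
  have := ler_enorm_dist (m *: v) (rho^-1 *: (p - x0)) 0.
  rewrite !subr0 enormZ v1 mulr1 (gtr0_norm m0); move: pm; rewrite /m; lra.
have := ler_enorm_dist (m *: v) w (rho^-1 *: (p - x0)).
have -> : w - m *: v = (e / 2) *: v.
  by rewrite {1}wE -scalerBl /m opprB addrC subrK.
rewrite enormZ v1 mulr1 (enorm_distC (m *: v)) gtr0_norm; last lra.
lra.
Unshelve. all: by end_near. Qed.
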